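(* There exist fibers on which the symmetry group does not act transitively; that is, there exist an architecture $(n_0,\ldots,n_m)$ and a function $f\in\mathcal{M}_{n_0,\ldots,n_m}$ such that the action of $\mathrm{Aut}(\mathcal{P}_{n_0,\ldots,n_m})$ on the fiber $\rho^{-1}(f)$ is not transitive.
   Context: An architecture is a tuple $(n_0,\ldots,n_m)$ of positive integers with $m\ge 1$. Let $\sigma$ denote the map applying $t\mapsto\max\{0,t\}$ to each coordinate of a vector in any $\mathbb{R}^n$. Put $D(n_0,\ldots,n_m)=\sum_{i=1}^m n_i(n_{i-1}+1)$ and $\mathcal{P}_{n_0,\ldots,n_m}=\mathbb{R}^{D(n_0,\ldots,n_m)}$ (parameter space, with its Euclidean topology). A parameter $\theta\in\mathcal{P}_{n_0,\ldots,n_m}$ is identified with a list of matrices $[A^i]$ of size $n_i\times(n_{i-1}+1)$, $1\le i\le m$, giving affine maps $A^i:\mathbb{R}^{n_{i-1}}\to\mathbb{R}^{n_i}$, $A^i(x)=[A^i][x,1]^T$. The realization map $\rho:\mathcal{P}_{n_0,\ldots,n_m}\to C(\mathbb{R}^{n_0},\mathbb{R}^{n_m})$ sends $\theta$ to the function $\rho(\theta)=\sigma\circ A^m\circ\cdots\circ\sigma\circ A^1$. The moduli space $\mathcal{M}_{n_0,\ldots,n_m}$ is the image of $\rho$, and for $f\in\mathcal{M}_{n_0,\ldots,n_m}$ the fiber of $f$ is $\rho^{-1}(f)\subset\mathcal{P}_{n_0,\ldots,n_m}$. The symmetry group $\mathrm{Aut}(\mathcal{P}_{n_0,\ldots,n_m})$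 is the group of all homeomorphisms $T$ of $\mathcal{P}_{n_0,\ldots,n_m}$ such that $\rho=\rho\circ T$; it preserves each fiber and hence acts on it. *)

(* Defs.v *)
From HB Require Import structures.
From mathcomp Require Import all_boot all_order all_algebra.
From mathcomp Require Import all_classical all_reals all_analysis.

Set Implicit Arguments.
Unset Strict Implicit.
Unset Printing Implicit Defensive.

Import Order.TTheory GRing.Theory Num.Theory.
Import numFieldNormedType.Exports.

Local Open Scope classical_set_scope.
Local Open Scope ring_scope.

(* The tuple (n_0, n_1, ..., n_m) is given by its head n0 and its tail
   ns = [:: n_1; ...; n_m], so that m = size ns and n_m = last n0 ns. *)
Definition is_architecture (n0 : nat) (ns : seq nat) : bool :=
  (0 < size ns)%N && all (ltn 0) (n0 :: ns).

Fixpoint param_dim (n0 : nat) (ns : seq nat) : nat :=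
  if ns is n1 :: ns' then (n1 * (n0 + 1) + param_dim n1 ns')%N else 0%N.

Lemma param_dimE (n0 : nat) (ns : seq nat) :
  param_dim n0 ns =
  (\sum_(1 <= i < (size ns).+1)
     nth 0 (n0 :: ns) i * (nth 0 (n0 :: ns) i.-1 + 1))%N.
Proof.
elim: ns n0 => [|n1 ns IH] n0; first by rewrite big_nil.
by rewrite [LHS]/= IH !big_add1 [RHS]big_nat_recl.
Qed.

(* The topology of 'rV[R]_D in the library is that of the sup norm, hence
   the Euclidean topology of R^D. *)
Notation param R n0 ns := 'rV[R]_(param_dim n0 ns).

Section Network.
Variable R : realType.

Definition relu (n : nat) (x : 'cV[R]_n) : 'cV[R]_n :=
  map_mx (fun t => Num.max 0 t) x.

Definition affine_of (n k : nat) (A : 'M[R]_(k, n + 1)) (x : 'cV[R]_n) :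
  'cV[R]_k := A *m col_mx x 1%:M.

(* The first n_1 (n_0 + 1) coordinates of a parameter are the entries of
   [A^1], listed row by row, and the others are those of [A^2], ..., [A^m]. *)
Definition first_matrix (n0 n1 : nat) (ns : seq nat)
    (theta : param R n0 (n1 :: ns)) : 'M[R]_(n1, n0 + 1) :=
  vec_mx (lsubmx theta).

Definition other_matrices (n0 n1 : nat) (ns : seq nat)
    (theta : param R n0 (n1 :: ns)) : param R n1 ns :=
  rsubmx theta.

Fixpoint realization (n0 : nat) (ns : seq nat) :
    param R n0 ns -> 'cV[R]_n0 -> 'cV[R]_(last n0 ns) :=
  match ns with
  | [::] => fun _ => id
  | n1 :: ns' => fun theta =>
      realization (other_matrices theta) \o
        (@relu n1 \o affine_of (first_matrix theta))
  end.

Lemma layer_continuous (n k : nat) (A : 'M[R]_(k, n + 1)) :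
  continuous (@relu k \o affine_of A).
Proof.
have coord i j : continuous (fun y => (@relu k \o affine_of A) y i j).
  have -> : (fun y => (@relu k \o affine_of A) y i j) =
      (fun y : 'cV[R]_n => Num.max 0 (\sum_l A i l * col_mx y 1%:M l j)).
    by apply/funext => y; rewrite /relu /affine_of /= !mxE.
  move=> x; apply: (@continuous_max _ _ (fun=> 0) _ x).
    exact: cst_continuous.
  apply: (@cvg_big R _ +%R 0 xpredT _ _ (nbhs (x : 'cV[R]_n))).
    exact: (@pseudometric_normed_Zmodule.add_continuous R R).
  move=> l _; apply: cvgM; first exact: cvg_cst.
  case: (split_ordP l) => h ->.
    under eq_fun do rewrite col_mxEu.
    by rewrite col_mxEu; exact: coord_continuous.
  under eq_fun do rewrite col_mxEd.
  by rewrite col_mxEd; exact: cvg_cst.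
move=> x B [P nP sPB].
have : \forall y \near x, forall i j, P i j ((@relu k \o affine_of A) y i j).
  apply: (@filter_forall _ _ _ (nbhs (x : 'cV[R]_n))) => i;
    apply: (@filter_forall _ _ _ (nbhs (x : 'cV[R]_n))) => j.
  exact: (coord i j x _ (nP i j)).
by apply: filterS => y /sPB.
Qed.

Lemma realization_continuous (n0 : nat) (ns : seq nat) (theta : param R n0 ns) :
  continuous (realization theta).
Proof.
elim: ns n0 theta => [|n1 ns IH] n0 theta x; first by [].
apply: (@continuous_comp _ _ _ (@relu n1 \o affine_of (first_matrix theta))
  (realization (other_matrices theta))); last exact: IH.
exact: layer_continuous.
Qed.

Definition moduli_space (n0 : nat) (ns : seq nat) :
    set ('cV[R]_n0 -> 'cV[R]_(last n0 ns)) :=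
  range (@realization n0 ns).

Definition fiber (n0 : nat) (ns : seq nat)
    (f : 'cV[R]_n0 -> 'cV[R]_(last n0 ns)) : set (param R n0 ns) :=
  @realization n0 ns @^-1` [set f].

End Network.

Definition homeomorphism (X Y : topologicalType) (T : X -> Y) : Prop :=
  continuous T /\
  exists S : Y -> X, [/\ cancel T S, cancel S T & continuous S].

Definition symmetry_group (R : realType) (n0 : nat) (ns : seq nat) :
    set (param R n0 ns -> param R n0 ns) :=
  [set T | homeomorphism T /\
           @realization R n0 ns = @realization R n0 ns \o T].

Definition acts_transitively (X : Type) (G : set (X -> X)) (A : set X) : Prop :=
  forall x y, A x -> A y -> exists2 T, G T & T x = y.

Section SymmetryGroupTheory.
Variables (R : realType) (n0 : nat) (ns : seq nat).
Local Notation G := (@symmetry_group R n0 ns).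

Lemma symmetry_group_id : G id.
Proof.
by split=> //; split; [|exists id; split] => // x; exact: cvg_id.
Qed.

Lemma symmetry_group_comp T U : G T -> G U -> G (T \o U).
Proof.
move=> [[cT [T' [TK T'K cT']]] rT] [[cU [U' [UK U'K cU']]] rU].
split; last by rewrite compA -rT.
split; first by move=> x; apply: continuous_comp; [exact: cU|exact: cT].
exists (U' \o T'); split; [exact: can_comp|exact: can_comp|].
by move=> x; apply: continuous_comp; [exact: cT'|exact: cU'].
Qed.

Lemma symmetry_group_inv T U : G T -> cancel T U -> cancel U T -> G U.
Proof.
move=> [[cT [T' [TK T'K cT']]] rT] UK KU.
have -> : U = T' by apply/funext => x; rewrite -{1}[x]T'K UK.
split; first by split=> //; exists T; split.
by rewrite {2}rT -compA; apply/funext => x; rewrite /= T'K.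
Qed.

Lemma symmetry_group_fiber T f : G T -> T @` fiber f = fiber f.
Proof.
move=> [[_ [T' [TK T'K _]]] rT]; have rTE x := congr1 (@^~ x) rT.
apply/seteqP; split=> [_ [x fx <-]|x fx].
  by rewrite /fiber /= in fx *; rewrite -fx [RHS]rTE.
exists (T' x); last exact: T'K.
by rewrite /fiber /= in fx *; rewrite [LHS]rTE /= T'K.
Qed.

End SymmetryGroupTheory.

(* Main.v *)
Require Import Defs.
From mathcomp Require Import all_boot all_order all_algebra.
From mathcomp Require Import all_classical all_reals all_analysis.
From mathcomp Require Import lra.

(** In the architecture (1, 1), the parameter (a, b) realizes x |-> max(0, a x + b).
    A parameter (a, 0) with a > 0 is alone in its fiber, so every symmetry fixes
    it; letting a tend to 0, every symmetry fixes (0, 0). But the fiber of the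
    zero function also contains (0, -1). *)

Set Implicit Arguments.
Unset Strict Implicit.
Unset Printing Implicit Defensive.

Import Order.TTheory GRing.Theory Num.Theory.
Import numFieldNormedType.Exports.

Local Open Scope classical_set_scope.
Local Open Scope ring_scope.

Section OneNeuron.
Variable R : realType.

(** The final [0] is the empty block left for the layers after the first. *)
Definition neuron_param (a b : R) : param R 1 [:: 1%N] :=
  row_mx (mxvec (row_mx a%:M b%:M : 'M[R]_(1, 1 + 1))) 0.

Lemma neuron_paramP (theta : param R 1 [:: 1%N]) :
  exists a b, theta = neuron_param a b.
Proof.
pose A := first_matrix theta.
exists (lsubmx A 0 0), (rsubmx A 0 0).
rewrite /neuron_param -!mx11_scalar hsubmxK vec_mxK.
rewrite -[LHS](@hsubmxK R 1 (1 * (1 + 1)) 0 theta); congr row_mx.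
exact: thinmx0.
Qed.

(** Turns the parameters [(t, 0)] into a ray [t *: v], whose limit at [0] follows from continuity of
    scaling. *)
Lemma neuron_param_scale (t a b : R) :
  neuron_param (t * a) (t * b) = t *: neuron_param a b.
Proof.
rewrite /neuron_param scale_row_mx scaler0 -linearZ /=.
by rewrite scale_row_mx !scale_scalar_mx.
Qed.

Lemma neuron_param_inj (a b a' b' : R) :
  neuron_param a b = neuron_param a' b' -> a = a' /\ b = b'.
Proof.
move=> /eq_row_mx[] /(can_inj mxvecK) /eq_row_mx[] ea eb _.
by split; [move/matrixP: ea|move/matrixP: eb] => /(_ 0 0); rewrite !mxE.
Qed.

Lemma realization_neuron (a b : R) (x : 'cV[R]_1) :
  realization (neuron_param a b) x =
  (Num.max 0 (a * x 0 0 + b))%:M :> 'cV[R]_1.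
Proof.
rewrite /= /first_matrix /neuron_param row_mxKl mxvecK /affine_of.
rewrite (@mul_row_col R 1 1 1 1) mulmx1 mul_scalar_mx.
by rewrite [LHS]mx11_scalar !mxE !mulr1n.
Qed.

Lemma realization_neuron_inj (a a' b' : R) : 0 < a ->
  realization (neuron_param a 0) = realization (neuron_param a' b') ->
  neuron_param a' b' = neuron_param a 0.
Proof.
move=> a0 e.
have val x : Num.max 0 (a * x + 0) = Num.max 0 (a' * x + b').
  have /matrixP/(_ 0 0) := congr1 (@^~ (x%:M : 'cV[R]_1)) e.
  by rewrite !realization_neuron !mxE !mulr1n.
have [] : a' = a /\ b' = 0; last by move=> -> ->.
(* At [1] and [2] the left side is positive since [0 < a], so both neurons are active there; two
   values determine an affine function. *)
have := val 1; have := val 2.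
rewrite !maxEle.
by do 4 case: ifP; move=> *; split; lra.
Qed.

Lemma symmetry_fixes_zero (T : param R 1 [:: 1%N] -> param R 1 [:: 1]) :
  symmetry_group T -> T 0 = 0.
Proof.
move=> [[cT _] rT].
pose v : param R 1 [:: 1%N] := neuron_param 1 0.
have fix_pos t : 0 < t -> T (t *: v) = t *: v.
  move=> t0; rewrite /v -neuron_param_scale mulr1 mulr0.
  have [a' [b' e]] := neuron_paramP (T (neuron_param t 0)).
  rewrite e; apply: realization_neuron_inj => //.
  by rewrite -e {1}rT.
have cv : t *: v @[t --> 0^'+] --> (0 : param R 1 [:: 1%N]).
  rewrite -(scale0r v); apply: cvg_at_right_filter.
  exact: scalel_continuous.
have cTv : T (t *: v) @[t --> 0^'+] --> T 0.
  by apply: continuous_cvg => //; exact: cT.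
(* [T (t *: v)] also tends to [0], because it equals [t *: v] for [t > 0]; limits being unique,
   [T 0 = 0]. *)
apply: (cvg_unique _ cTv); first exact: norm_hausdorff.
apply: cvg_trans cv; apply: near_eq_cvg.
by near=> t; rewrite fix_pos.
Unshelve. all: by end_near. Qed.

End OneNeuron.

Theorem proposition11p5 (R : realType) :
  exists (n0 : nat) (ns : seq nat), is_architecture n0 ns /\
    exists f : 'cV[R]_n0 -> 'cV[R]_(last n0 ns),
      @moduli_space R n0 ns f /\
      ~ acts_transitively (@symmetry_group R n0 ns) (@fiber R n0 ns f).
Proof.
exists 1%N, [:: 1%N]; split=> //.
have zeroE : neuron_param 0 0 = 0 :> param R 1 [:: 1%N].
  by rewrite -(scale0r (neuron_param 0 0)) -neuron_param_scale mul0r.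
exists (realization (neuron_param 0 0)); split; first by exists (neuron_param 0 0).
(* With zero slope, the negative bias [-1] is clipped to [0], so both parameters realize the zero
   function. *)
move=> /(_ (neuron_param 0 0) (neuron_param 0 (-1)) erefl)[].
  apply/funext => x; rewrite !realization_neuron !mul0r !add0r.
  by rewrite maxxx max_l// lerN10.
move=> T /symmetry_fixes_zero T0; rewrite zeroE T0 -zeroE.
by move=> /neuron_param_inj[_]; lra.
Qed.
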